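(* For $n\ge 5$, the alternating group $\mathrm{Alt}(n)$, acting naturally on $\{1,\dots,n\}$, has no non-canonical Cameron-Liebler sets.
   Context: For a group $G$ acting on $\Omega$ and $a,b\in\Omega$, the star is $G_{a\to b}=\{g\in G:g(a)=b\}$ with indicator vector $\mathbf{v}_{a,b}$. A Cameron-Liebler (CL) set is a subset of $G$ whose indicator vector is a linear combination of the $\mathbf{v}_{a,b}$. A CL set is canonical if it is a star or a union of pairwise disjoint stars, and non-canonical otherwise. *)

(* Defs.v *)
From HB Require Import structures.
From mathcomp Require Import all_boot all_order all_algebra all_fingroup all_solvable.

Set Implicit Arguments.
Unset Strict Implicit.
Unset Printing Implicit Defensive.

Import GroupScope GRing.Theory.

Definition star (gT : finGroupType) (T : finType) (to : {action gT &-> T})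
    (G : {group gT}) (a b : T) : {set gT} :=
  amove to G a b.

Definition is_star (gT : finGroupType) (T : finType) (to : {action gT &-> T})
    (G : {group gT}) (A : {set gT}) : Prop :=
  exists a b : T, A = star to G a b.

(* Vectors indexed by G are represented as functions on the ambient type gT;
   all those considered below vanish outside G. The regular algebra F^o only
   serves to equip the functions with their F-vector space structure. *)
Definition indicator (F : numFieldType) (gT : finGroupType) (A : {set gT}) :
    {ffun gT -> F^o} :=
  [ffun g => (g \in A)%:R%R].

Definition CL_set (F : numFieldType) (gT : finGroupType) (T : finType)
    (to : {action gT &-> T}) (G : {group gT}) (S : {set gT}) : Prop :=
  S \subset G /\
  exists c : T -> T -> F,
    indicator F S =
      (\sum_(a : T) \sum_(b : T) c a b *: indicator F (star to G a b))%R.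

(* The family P may be empty, so that the empty set is canonical. *)
Definition canonical (gT : finGroupType) (T : finType)
    (to : {action gT &-> T}) (G : {group gT}) (S : {set gT}) : Prop :=
  is_star to G S \/
  exists P : {set {set gT}},
    [/\ forall A : {set gT}, A \in P -> is_star to G A,
        trivIset P
      & S = cover P].

Definition noncanonical_CL_set (F : numFieldType) (gT : finGroupType)
    (T : finType) (to : {action gT &-> T}) (G : {group gT}) (S : {set gT}) :
    Prop :=
  CL_set F to G S /\ ~ canonical to G S.

(* Main.v *)
(* Write the indicator of S as f(g) = sum_a c a (g a). Composing g with the
   transposition (i j) changes f by the cross difference
   D = c i x + c j y - c i y - c j x, where x = g i and y = g j.
   - 3-cycles preserve parity, so 3 D is an integer. Products of two disjoint
     transpositions preserve it too, so integrality of D passes to every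
     cross difference on disjoint rows and columns; on a fixed pair of rows, four
     columns then force one D, hence all of them, to be an integer.
   - Consequently f is {0,1}-valued on odd permutations as well: on a 3 x 3 block
     the three even sums and the three odd sums have the same total.
   - Applying two disjoint transpositions separately and together to a
     {0,1}-valued f shows that two cross differences on disjoint rows and columns
     cannot both be nonzero. For n >= 5 this forces D to vanish off a single row r
     or off a single column p, so that f(g) depends only on g(r), or only on
     g^-1(p), and S is a disjoint union of stars. *)
Require Import Defs.
From mathcomp Require Import all_boot all_order all_algebra all_fingroup all_solvable.
From mathcomp Require Import ring zify.

Set Implicit Arguments.
Unset Strict Implicit.
Unset Printing Implicit Defensive.

Import GroupScope GRing.Theory Num.Theory.
Local Open Scope ring_scope.

Definition perm_sum (F : numFieldType) (T : finType) (c : T -> T -> F)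
    (g : {perm T}) : F := \sum_a c a (g a).

(** Additive analogue of a 2 x 2 minor: it vanishes identically exactly when [c i x] splits as a
    function of [i] plus a function of [x]. *)
Definition cross (R : zmodType) (T : Type) (c : T -> T -> R) (i j x y : T) : R :=
  c i x + c j y - c i y - c j x.

Definition boolean (R : pzRingType) (x : R) : Prop := exists b : bool, x = b%:R.

Ltac uniq_tac :=
  rewrite /= ?inE ?negb_or; repeat (apply/andP; split=> //); by rewrite 1?eq_sym.

(** * Extending partial injections to permutations *)

Lemma exists_notin (T : finType) (s : seq T) :
  (size s < #|T|)%N -> exists x, x \notin s.
Proof.
move=> hs; apply/existsP; apply: contraLR hs => /existsPn h.
rewrite -leqNgt cardE; apply: uniq_leq_size (enum_uniq _) _ => x _.
by rewrite -[_ \in _]negbK h.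
Qed.

Lemma perm_extend (T : finType) (s t : seq T) :
  uniq s -> uniq t -> size s = size t -> exists g : {perm T}, map g s = t.
Proof.
elim: s t => [|x s IH] [|y t] //=; first by exists 1%g.
case/andP=> xs us /andP[yt ut] [/(IH t us ut)[g gst]].
exists (g * tperm (g x) y)%g; rewrite permM tpermL; congr (_ :: _).
rewrite -[RHS]gst; apply/eq_in_map => z zs; rewrite permM tpermD //.
  by rewrite (inj_eq perm_inj); apply: contraNneq xs => ->.
by apply: contraNneq yt => ->; rewrite -gst map_f.
Qed.

(** Swapping two points outside [s] corrects the parity and keeps the prescribed values; the size
    bound provides these two points. *)
Lemma even_perm_extend (T : finType) (s t : seq T) :
    uniq s -> uniq t -> size s = size t -> (size s + 2 <= #|T|)%N ->
  exists2 g : {perm T}, ~~ odd_perm g & map g s = t.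
Proof.
move=> us ut st sT; have [g gst] := perm_extend us ut st.
have [g1|] := boolP (odd_perm g); last by exists g.
have [|l ls] := @exists_notin _ s; first by apply: leq_trans sT; rewrite addn2 ltnW.
have [|m] := @exists_notin _ (l :: s); first by apply: leq_trans sT; rewrite addn2.
rewrite inE negb_or => /andP[ml ms].
exists (tperm l m * g)%g; first by rewrite odd_permM odd_tperm g1 eq_sym ml.
rewrite -gst; apply/eq_in_map => x xs; rewrite permM tpermD //.
  by apply: contraNneq ls => ->.
by apply: contraNneq ms => ->.
Qed.

(** * Sums along a permutation and cross differences *)

Section PermSum.
Variables (F : numFieldType) (T : finType).
Implicit Types (c : T -> T -> F) (g h : {perm T}) (i j k l x y z w : T).

Lemma perm_sum_tperm c g i j :
  perm_sum c (tperm i j * g)%g = perm_sum c g - cross c i j (g i) (g j).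
Proof.
have [->|ij] := eqVneq i j.
  by rewrite tperm1 mul1g /cross; ring.
rewrite /perm_sum (bigD1 i) //= (bigD1 j) 1?eq_sym //=.
rewrite [in RHS](bigD1 i) //= [in RHS](bigD1 j) 1?eq_sym //=.
rewrite !permM tpermL tpermR.
under eq_bigr => a /andP[ai aj].
  by rewrite permM tpermD 1?eq_sym //; over.
by rewrite /cross; ring.
Qed.

(** Transposing the matrix [c] inverts the permutation; this reduces the column case to the row
    case. *)
Lemma perm_sum_trans c g : perm_sum (fun a b => c b a) g = perm_sum c g^-1%g.
Proof.
rewrite /perm_sum (reindex_inj (@perm_inj _ g^-1%g)) /=.
by apply: eq_bigr => a _; rewrite permKV.
Qed.

Lemma perm_sum_row c r g h :
    (forall i j x y, i != r -> j != r -> cross c i j x y = 0) ->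
  g r = h r -> perm_sum c g = perm_sum c h.
Proof.
move=> cr ghr.
have [k kr|r1] := pickP (predC1 r); last first.
  rewrite /perm_sum (eq_bigr (fun a => c a (h a))) // => a _.
  by have /negbFE/eqP-> := r1 a; rewrite ghr.
rewrite /perm_sum (bigD1 r) //= [RHS](bigD1 r) //= ghr; congr (_ + _).
(* Off row [r], every row is row [k] plus a constant, so the remaining sum is a sum of row [k] over
   all columns but [f r]. *)
have E (f : {perm T}) : \sum_(i | i != r) c i (f i) =
    \sum_(i | i != r) (c i r - c k r) + (\sum_x c k x - c k (f r)).
  rewrite [\sum_x c k x](reindex_inj (@perm_inj _ f)) (bigD1 r) //=.
  rewrite [c k (f r) + _]addrC addrK -big_split /=; apply: eq_bigr => i ir.
  have := cr i k (f i) r ir kr; rewrite /cross => e.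
  by apply/eqP; rewrite -subr_eq0 -[X in _ == X]e; apply/eqP; ring.
by rewrite !E ghr.
Qed.

Lemma cross_row c i j k x y :
  cross c i j x y = cross c i k x y - cross c j k x y.
Proof. by rewrite /cross; ring. Qed.

Lemma cross_col c i j x y z :
  cross c i j x y = cross c i j x z - cross c i j y z.
Proof. by rewrite /cross; ring. Qed.

Lemma crossrr c i x y : cross c i i x y = 0.
Proof. by rewrite /cross; ring. Qed.

Lemma crosscc c i j x : cross c i j x x = 0.
Proof. by rewrite /cross; ring. Qed.

Lemma cross_trans c i j x y :
  cross (fun a b => c b a) x y i j = cross c i j x y.
Proof. by rewrite /cross; ring. Qed.

(** * From disjointness to support on one row or column *)

Hypothesis T5 : (5 <= #|T|)%N.

(** Serves for two rows of [c], each taken relative to a common third row. *)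
Lemma disjoint_variation (U : eqType) (r s : T -> U) :
    (forall x y z w, uniq [:: x; y; z; w] -> r x != r y -> s z = s w) ->
  [\/ forall x y, r x = r y, forall x y, s x = s y |
   exists p, forall x y, x != p -> y != p -> r x = r y /\ s x = s y].
Proof.
move=> H.
have [/'forall_'forall_eqP|] := boolP [forall x, forall y, r x == r y].
  by constructor 1.
rewrite negb_forall => /existsP[x0]; rewrite negb_forall => /existsP[y0 rxy0].
(* Here [p] is [x]: [s] separates [x] from all points but possibly [y], so a variation of [r] away
   from [x] would contradict this at a fifth point [w]. Then [r] separates [x] from everything,
   which makes [s] constant off [x]. *)
have main x y t : r x != r y -> t != x -> t != y -> s x != s t ->
    exists p, forall x y, x != p -> y != p -> r x = r y /\ s x = s y.
  move=> rxy tx ty sxt; have xy : x != y by apply: contraNneq rxy => ->.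
  have sx u : u != x -> u != y -> s x != s u.
    move=> ux uy; have [->//|ut] := eqVneq u t.
    by rewrite -(H x y t u) //; uniq_tac.
  have rx u v : u != x -> v != x -> r u = r v.
    move=> ux vx; apply/eqP; apply: contraT => ruv.
    have uv : u != v by apply: contraNneq ruv => ->.
    have [w] := @exists_notin _ [:: x; y; u; v] T5.
    rewrite !inE !negb_or => /and4P[wx wy wu wv].
    by move: (sx w wx wy); rewrite (H u v x w) ?eqxx //; uniq_tac.
  exists x => u v ux vx; split; first exact: rx.
  apply/eqP; apply: contraT => suv.
  have uv : u != v by apply: contraNneq suv => ->.
  have [w] := @exists_notin _ [:: x; u; v] (ltnW T5).
  rewrite !inE !negb_or => /and3P[wx wu wv].
  rewrite (H x w u v) ?eqxx // in suv; first by uniq_tac.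
  by rewrite (rx w y) // eq_sym.
have [/existsP[t /and3P[tx ty]]|] :=
  boolP [exists t, [&& t != x0, t != y0 & (s x0 != s t) || (s y0 != s t)]].
  case/orP=> [sxt|syt]; constructor 3; first exact: (main x0 y0 t).
  by apply: (main y0 x0 t) => //; rewrite eq_sym.
rewrite negb_exists => /forallP h; constructor 2.
have [w] := @exists_notin _ [:: x0; y0] (ltnW (ltnW T5)).
rewrite !inE !negb_or => /andP[wx wy].
have {}h t : t != x0 -> t != y0 -> s x0 = s t /\ s y0 = s t.
  by move=> tx ty; have := h t; rewrite tx ty /= negb_or !negbK => /andP[/eqP-> /eqP->].
suff sw x : s x = s w by move=> x y; rewrite !sw.
have [->|xx] := eqVneq x x0; first by case: (h w wx wy).
have [->|xy] := eqVneq x y0; first by case: (h w wx wy).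
by case: (h x xx xy) => <- _; case: (h w wx wy).
Qed.

Definition row_or_col_supported c :=
  (exists r, forall i j x y, i != r -> j != r -> cross c i j x y = 0) \/
  (exists p, forall i j x y, x != p -> y != p -> cross c i j x y = 0).

Definition disjoint_free c :=
  forall i j k l x y z w, uniq [:: i; j; k; l] -> uniq [:: x; y; z; w] ->
  cross c i j x y != 0 -> cross c k l z w = 0.

(** All rows but [a] and [b] are parallel to a reference row [k]. The three outcomes of
    [disjoint_variation] for rows [a] and [b] minus row [k] give the exceptional row [b], row [a] or
    column [p]. *)
Lemma two_rows_support c a b : disjoint_free c -> a != b ->
    (forall k l x y, k \notin [:: a; b] -> l \notin [:: a; b] ->
       cross c k l x y = 0) ->
  row_or_col_supported c.
Proof.
move=> H ab Z.
have [k kab] := @exists_notin _ [:: a; b] (ltnW (ltnW T5)).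
have E i x y : (c i x - c k x == c i y - c k y) = (cross c i k x y == 0).
  by rewrite -[LHS]subr_eq0; congr (_ == 0); rewrite /cross; ring.
have Zk i x y : i != a -> i != b -> cross c i k x y = 0.
  by move=> ia ib; apply: Z => //; rewrite !inE negb_or ia.
have [] := @disjoint_variation F (fun x => c a x - c k x) (fun x => c b x - c k x).
- move=> x y z w u; rewrite E => ne; apply/eqP; rewrite E.
  have [l] := @exists_notin _ [:: a; b; k] (ltnW T5).
  move: (kab); rewrite !inE !negb_or => /andP[ka kb] /and3P[la lb lk].
  rewrite (cross_row _ _ _ l) (H a k b l x y z w) //; last by uniq_tac.
  by rewrite (Z k l) ?subrr // !inE negb_or la.
- move=> h; left; exists b => i j x y ib jb.
  have h' e : e != b -> cross c e k x y = 0.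
    have [->|ea eb] := eqVneq e a; last exact: Zk.
    by move=> _; apply/eqP; rewrite -E (h x y).
  by rewrite (cross_row _ _ _ k) !h' ?subrr.
- move=> h; left; exists a => i j x y ia ja.
  have h' e : e != a -> cross c e k x y = 0.
    have [->|eb ea] := eqVneq e b; last exact: Zk.
    by move=> _; apply/eqP; rewrite -E (h x y).
  by rewrite (cross_row _ _ _ k) !h' ?subrr.
- case=> p h; right; exists p => i j x y xp yp.
  have [e1 e2] := h x y xp yp.
  have h' e : cross c e k x y = 0.
    have [->|ea] := eqVneq e a; first by apply/eqP; rewrite -E e1.
    have [->|eb] := eqVneq e b; first by apply/eqP; rewrite -E e2.
    exact: Zk.
  by rewrite (cross_row _ _ _ k) !h' subrr.
Qed.

Lemma disjoint_free_support c : disjoint_free c -> row_or_col_supported c.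
Proof.
move=> H.
have [r _] := @exists_notin _ [::] (ltnW (ltnW (ltnW (ltnW T5)))).
have [/existsP[[[a b] [p q]] /= ne]|] :=
  boolP [exists t : (T * T) * (T * T), cross c t.1.1 t.1.2 t.2.1 t.2.2 != 0];
  last first.
  rewrite negb_exists => /forallP h; left; exists r => i j x y _ _.
  by apply/eqP; have := h ((i, j), (x, y)); rewrite negbK.
have ab : a != b by apply: contraNneq ne => ->; rewrite crossrr.
have pq : p != q by apply: contraNneq ne => ->; rewrite crosscc.
have Z k l z w : k \notin [:: a; b] -> l \notin [:: a; b] ->
    z \notin [:: p; q] -> w \notin [:: p; q] -> cross c k l z w = 0.
  rewrite !inE !negb_or => /andP[ka kb] /andP[la lb] /andP[zp zq] /andP[wp wq].
  have [->|kl] := eqVneq k l; first exact: crossrr.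
  have [->|zw] := eqVneq z w; first exact: crosscc.
  by apply: (H a b k l p q z w) => //; uniq_tac.
(* Without a nonzero cross difference on columns avoiding [p] and [q], [two_rows_support] applies to
   the transpose of [c]; with one, it applies to rows [a] and [b]. *)
have [/existsP[[[i i'] [z w]] /= /and3P[zpq wpq ne']]|] :=
  boolP [exists t : (T * T) * (T * T), [&& t.2.1 \notin [:: p; q],
    t.2.2 \notin [:: p; q] & cross c t.1.1 t.1.2 t.2.1 t.2.2 != 0]]; last first.
  rewrite negb_exists => /forallP h.
  have [] := @two_rows_support (fun x y => c y x) p q _ pq.
  - move=> x y z w i j k l ux ui; rewrite !(cross_trans c); exact: H.
  - move=> x y i j xpq ypq; rewrite (cross_trans c); apply/eqP.
    by have := h ((i, j), (x, y)); rewrite /= xpq ypq negbK.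
  - by case=> s hs; right; exists s => i j x y xs ys; rewrite -(cross_trans c) hs.
  - by case=> s hs; left; exists s => i j x y xs ys; rewrite -(cross_trans c) hs.
have zw : z != w by apply: contraNneq ne' => ->; rewrite crosscc.
apply: (two_rows_support H ab) => k l x y kab lab.
have [->|kl] := eqVneq k l; first exact: crossrr.
have [v] := @exists_notin _ [:: p; q; z; w] T5.
rewrite !inE !negb_or => /and4P[vp vq vz vw].
suff V u : cross c k l u v = 0 by rewrite (cross_col _ _ _ _ _ v) !V subrr.
have [upq|] := boolP (u \in [:: p; q]); last first.
  by move=> upq; apply: Z => //; rewrite !inE negb_or vp.
have [k' k'n] := @exists_notin _ [:: a; b; k; l] T5.
(* A nonzero cross difference on columns [z], [w] is moved to a row pair containing [k']. By [Z] its
   other row [e] is [a] or [b], so the pair avoids [k] and [l]. *)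
have [e ek'] : exists e, cross c e k' z w != 0.
  have [e0|] := eqVneq (cross c i k' z w) 0; last by exists i.
  by exists i'; move: ne'; rewrite (cross_row _ _ _ k') e0 sub0r oppr_eq0.
move: k'n; rewrite !inE !negb_or => /and4P[k'a k'b k'k k'l].
have eab : e \in [:: a; b].
  by apply: contraT => eab; rewrite Z ?eqxx // !inE ?negb_or ?k'a // in ek'.
move: kab lab zpq wpq; rewrite !inE !negb_or.
move=> /andP[ka kb] /andP[la lb] /andP[zp zq] /andP[wp wq].
apply: (H e k' k l z w u v) => //.
  by move: eab; rewrite !inE => /orP[]/eqP->; uniq_tac.
by move: upq; rewrite !inE => /orP[]/eqP->; uniq_tac.
Qed.
End PermSum.

(** * Integrality of cross differences and values on odd permutations *)

Definition isint (R : pzRingType) (x : R) : Prop := exists m : int, x = m%:~R.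

Definition bool_diff (R : pzRingType) (x : R) : Prop :=
  exists b b' : bool, x = b%:R - b'%:R.

Lemma isintB (R : pzRingType) (x y : R) : isint x -> isint y -> isint (x - y).
Proof. by move=> [m ->] [p ->]; exists (m - p); rewrite rmorphB. Qed.

Lemma isintD (R : pzRingType) (x y : R) : isint x -> isint y -> isint (x + y).
Proof. by move=> [m ->] [p ->]; exists (m + p); rewrite rmorphD. Qed.

Lemma bool_diff_int (R : pzRingType) (x : R) : bool_diff x -> isint x.
Proof.
by move=> [b [b' ->]]; exists (b%:Z - b'%:Z); rewrite rmorphB /= !pmulrn.
Qed.

Lemma dvd3_or_dvd3_sub (m1 m2 m3 : int) :
  [|| 3 %| m1, 3 %| m2, 3 %| m3, 3 %| m2 - m1, 3 %| m3 - m1 | 3 %| m3 - m2]%Z.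
Proof. lia. Qed.

Section Integrality.
Variables (F : numFieldType) (T : finType).
Implicit Types (g h : {perm T}) (i j k l x y z w : T).
Hypothesis T5 : (5 <= #|T|)%N.
Variable c : T -> T -> F.
Hypothesis even_bool : forall g, ~~ odd_perm g -> boolean (perm_sum c g).

(** Compares an even permutation with its product by a 3-cycle. Only three values are prescribed, so
    five points suffice to choose an even extension. *)
Lemma cross_cycle i j k x y z : uniq [:: i; j; k] -> uniq [:: x; y; z] ->
  bool_diff (cross c j k y z + cross c i j x z).
Proof.
move=> u v; have [g ge [gi gj gk]] := even_perm_extend u v erefl T5.
have ne : (i != j) * (i != k) * (j != k).
  by move: u; rewrite /= !inE negb_or andbT => /andP[/andP[-> ->] ->].
have [b eb] := even_bool ge.
have [|b' eb'] := @even_bool (tperm i j * (tperm j k * g))%g.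
  by rewrite !odd_permM !odd_tperm !ne (negbTE ge).
exists b, b'; rewrite -eb -eb' !perm_sum_tperm !permM tpermL tpermD 1?eq_sym ?ne //.
by rewrite gi gj gk; ring.
Qed.

(** With five points, four prescribed values fix the parity of [g]. If [g] is even, it is compared
    with its product by both transpositions; if odd, its products by each one are compared, whence
    the sign. *)
Lemma cross_pair i j k l x y z w :
  uniq [:: i; j; k; l] -> uniq [:: x; y; z; w] ->
  bool_diff (cross c i j x y + cross c k l z w) \/
  bool_diff (cross c i j x y - cross c k l z w).
Proof.
move=> u v; have [g [gi gj gk gl]] := perm_extend u v erefl.
have ne : (i != j) * (k != l) * (i != k) * (i != l) * (j != k) * (j != l).
  move: u; rewrite /= !inE !negb_or andbT.
  by move=> /and3P[/and3P[-> -> ->] /andP[-> ->] ->].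
have [go|ge] := boolP (odd_perm g).
  right; have [|b eb] := @even_bool (tperm k l * g)%g.
    by rewrite odd_permM odd_tperm ne go.
  have [|b' eb'] := @even_bool (tperm i j * g)%g.
    by rewrite odd_permM odd_tperm ne go.
  exists b, b'; rewrite -eb -eb' !perm_sum_tperm.
  by rewrite gi gj gk gl; ring.
left; have [b eb] := even_bool ge.
have ti : tperm k l i = i by rewrite tpermD // eq_sym ne.
have tj : tperm k l j = j by rewrite tpermD // eq_sym ne.
have [|b' eb'] := @even_bool (tperm i j * (tperm k l * g))%g.
  by rewrite !odd_permM !odd_tperm !ne (negbTE ge).
exists b, b'; rewrite -eb -eb' !perm_sum_tperm !permM ti tj.
by rewrite gi gj gk gl; ring.
Qed.

Lemma int_cross_disjoint i j k l x y z w :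
  uniq [:: i; j; k; l] -> uniq [:: x; y; z; w] ->
  isint (cross c i j x y) -> isint (cross c k l z w).
Proof.
move=> u v ix.
have [/bool_diff_int/isintB/(_ ix)|/bool_diff_int/(isintB ix)] := cross_pair u v.
  by rewrite addrC addKr.
by rewrite opprB addrC subrK.
Qed.

(* With rows i, j, k and columns x, y, z, the sum over even bijections equals the
   sum over odd ones, and D is the difference of one even and one odd term. *)
Lemma int_3cross i j x y : i != j -> x != y -> isint (cross c i j x y *+ 3).
Proof.
move=> ij xy.
have [k] := @exists_notin _ [:: i; j] (ltnW (ltnW T5)).
have [z] := @exists_notin _ [:: x; y] (ltnW (ltnW T5)).
rewrite !inE !negb_or => /andP[zx zy] /andP[ki kj].
have u : uniq [:: i; j; k] by uniq_tac.
have A x1 y1 z1 v := bool_diff_int (@cross_cycle i j k x1 y1 z1 u v).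
have -> : cross c i j x y *+ 3 =
    (cross c j k y z + cross c i j x z) - (cross c j k z x + cross c i j y x)
    - ((cross c j k x z + cross c i j y z) - (cross c j k z y + cross c i j x y)).
  by rewrite /cross; ring.
by do 2![apply: isintB]; apply: A; uniq_tac.
Qed.

Lemma int_cross i j x y : isint (cross c i j x y).
Proof.
have int0 : isint (0 : F) by exists 0.
have [->|ij] := eqVneq i j; first by rewrite crossrr.
have [->|xy] := eqVneq x y; first by rewrite crosscc.
have [k] := @exists_notin _ [:: i; j] (ltnW (ltnW T5)).
rewrite !inE !negb_or => /andP[ki kj].
have [l] := @exists_notin _ [:: i; j; k] (ltnW T5).
rewrite !inE !negb_or => /and3P[li lj lk].
(* Integrality passes to the disjoint block with rows [k], [l] and columns [z], [w], and back to
   columns [p], [r]. *)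
have step p q r : p != q -> isint (cross c i j p q) -> isint (cross c i j p r).
  move=> pq ipq; have [->|pr] := eqVneq p r; first by rewrite crosscc.
  have [z] := @exists_notin _ [:: p; q; r] (ltnW T5).
  rewrite !inE !negb_or => /and3P[zp zq zr].
  have [w] := @exists_notin _ [:: p; q; r; z] T5.
  rewrite !inE !negb_or => /and4P[wp wq wr wz].
  apply: (@int_cross_disjoint k l i j z w p r); try uniq_tac.
  by apply: (@int_cross_disjoint i j k l p q z w) => //; uniq_tac.
have from_pair p q : p != q -> isint (cross c i j p q) -> isint (cross c i j x y).
  move=> pq ipq.
  have -> : cross c i j x y = cross c i j p y - cross c i j p x.
    by rewrite /cross; ring.
  by apply: isintB; apply: step pq ipq.
have [z] := @exists_notin _ [:: x; y] (ltnW (ltnW T5)).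
rewrite !inE !negb_or => /andP[zx zy].
have [w] := @exists_notin _ [:: x; y; z] (ltnW T5).
rewrite !inE !negb_or => /and3P[wx wy wz].
have div3 (d : F) (m : int) : d *+ 3 = m%:~R -> (3 %| m)%Z -> isint d.
  move=> dm /dvdzP[e em]; exists e; apply/(@mulIf _ 3%:R); first by rewrite pnatr_eq0.
  by rewrite mulr_natr dm em rmorphM.
have [m1 e1] := int_3cross ij xy.
have [|m2 e2] := @int_3cross i j x z ij; first by rewrite eq_sym.
have [|m3 e3] := @int_3cross i j x w ij; first by rewrite eq_sym.
have D p q m m' : cross c i j x p *+ 3 = m%:~R -> cross c i j x q *+ 3 = m'%:~R ->
    cross c i j p q *+ 3 = (m' - m)%:~R.
  by move=> e e'; rewrite rmorphB /= -e -e' /cross; ring.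
(* By pigeonhole modulo 3, some pair among the columns [x], [y], [z], [w] has an integral cross
   difference. *)
case/or4P: (dvd3_or_dvd3_sub m1 m2 m3) => [d|d|d|/or3P[]d].
- exact: div3 d.
- by apply: (from_pair x z); [rewrite eq_sym|apply: div3 d].
- by apply: (from_pair x w); [rewrite eq_sym|apply: div3 d].
- by apply: (from_pair y z); [rewrite eq_sym|apply: div3 (D _ _ _ _ e1 e2) d].
- by apply: (from_pair y w); [rewrite eq_sym|apply: div3 (D _ _ _ _ e1 e3) d].
- by apply: (from_pair z w); [rewrite eq_sym|apply: div3 (D _ _ _ _ e2 e3) d].
Qed.

Lemma perm_sum_boolean g : boolean (perm_sum c g).
Proof.
have [go|/even_bool//] := boolP (odd_perm g).
have [i _] := @exists_notin _ [::] (ltnW (ltnW (ltnW (ltnW T5)))).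
have [j] := @exists_notin _ [:: i] (ltnW (ltnW (ltnW T5))).
have [k] := @exists_notin _ [:: i; j] (ltnW (ltnW T5)).
rewrite !inE !negb_or => /andP[ki kj] ji.
have even_tperm a b : a != b -> boolean (perm_sum c g - cross c a b (g a) (g b)).
  move=> ab; rewrite -perm_sum_tperm; apply: even_bool.
  by rewrite odd_permM odd_tperm ab go.
have gi := @perm_inj _ g; have u : uniq [:: i; j; k] by uniq_tac.
(* [cross_cycle] speaks of cross differences alone, so it bounds the effect of 3-cycles at the odd
   [g] too. *)
have [|a [a' ea]] := @cross_cycle i j k (g i) (g j) (g k) u.
  by rewrite (map_inj_uniq gi [:: i; j; k]).
have [|b [b' eb]] := @cross_cycle i j k (g j) (g k) (g i) u.
  by rewrite (map_inj_uniq gi [:: j; k; i]); uniq_tac.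
have [|p ep] := even_tperm i j; first by rewrite eq_sym.
have [|q eq] := even_tperm j k; first by rewrite eq_sym.
have [|r er] := even_tperm i k; first by rewrite eq_sym.
have [m em] : isint (perm_sum c g).
  rewrite -(subrK (cross c i j (g i) (g j)) (perm_sum c g)) ep.
  by apply: isintD (int_cross _ _ _ _); exists p%:Z; rewrite pmulrn.
(* Equality of the odd and even sums on the 3 x 3 block. The right side lies between -2 and 5, which
   leaves only 0 and 1 for [m]. *)
have E : (m *+ 3)%:~R = (p%:Z + q%:Z + r%:Z + (a%:Z - a'%:Z) - (b%:Z - b'%:Z))%:~R :> F.
  rewrite rmorphMn !(rmorphD, rmorphN) /= -em -!pmulrn.
  by rewrite -ep -eq -er -ea -eb /cross; ring.
move: E => /intr_inj E.
have [m0|m1] : m = 0 \/ m = 1.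
  by clear -E; lia.
- by exists false; rewrite em m0.
- by exists true; rewrite em m1.
Qed.

Lemma cross_disjoint_free : disjoint_free c.
Proof.
move=> i j k l x y z w u v n1; apply/eqP; move: n1; apply: contraNT => n2.
have [g [gi gj gk gl]] := perm_extend u v erefl.
have ne : (i != k) * (i != l) * (j != k) * (j != l).
  move: u; rewrite /= !inE !negb_or andbT.
  by move=> /and3P[/and3P[_ -> ->] /andP[-> ->] _].
have ti : tperm k l i = i by rewrite tpermD // eq_sym ne.
have tj : tperm k l j = j by rewrite tpermD // eq_sym ne.
have [b0 e0] := perm_sum_boolean g.
have [b1 e1] := perm_sum_boolean (tperm i j * g)%g.
have [b2 e2] := perm_sum_boolean (tperm k l * g)%g.
have [b3 e3] := perm_sum_boolean (tperm i j * (tperm k l * g))%g.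
move: e1 e2 e3; rewrite !perm_sum_tperm !permM.
rewrite ti tj gi gj gk gl e0 => e1 e2 e3.
have d1 : cross c i j x y = b0%:R - b1%:R by rewrite -e1; ring.
have d2 : cross c k l z w = b0%:R - b2%:R by rewrite -e2; ring.
(* If both cross differences were nonzero, [b1] and [b2] would both differ from [b0], and [b3] would
   be 2 or -1. *)
have E : (b3%:Z)%:~R = (b1%:Z + b2%:Z - b0%:Z)%:~R :> F.
  by rewrite rmorphB rmorphD /= -!pmulrn -e3 d1 d2; ring.
move: E n2 => /intr_inj E; rewrite d1 d2.
by case: b0 b1 b2 b3 E {e0 e1 e2 e3 d1 d2} => [] [] [] [] //=; rewrite ?subrr ?eqxx.
Qed.

End Integrality.

Lemma canonical_cover (gT : finGroupType) (T : finType) (to : {action gT &-> T})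
    (G : {group gT}) (st : gT -> {set gT}) (S : {set gT}) :
    (forall g, g \in S -> is_star to G (st g)) ->
    (forall g, g \in S -> g \in st g) ->
    (forall g h, g \in S -> h \in st g -> h \in S /\ st h = st g) ->
  canonical to G S.
Proof.
move=> star_st gst stS; right; exists (st @: S); split.
- by move=> A /imsetP[g gS ->]; apply: star_st.
(* Two members of the family that share a point [k] both equal [st k]. *)
- apply/trivIsetP => _ _ /imsetP[g gS ->] /imsetP[h hS ->].
  apply: contraR => /pred0Pn[k /andP[kg kh]].
  by have [_ <-] := stS g k gS kg; have [_ <-] := stS h k hS kh.
- apply/setP => g; rewrite cover_imset; apply/idP/bigcupP => [gS|[h hS /(stS h g hS)[]//]].
  by exists g => //; apply: gst.
Qed.

Lemma in_star_perm (T : finType) (G : {group {perm T}}) (a b : T) (g : {perm T}) :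
  (g \in star 'P G a b) = (g \in G) && (g a == b).
Proof. by rewrite inE. Qed.

Lemma Alt_CL_set_canonical (F : numFieldType) (T : finType) (S : {set {perm T}}) :
  (5 <= #|T|)%N -> CL_set F 'P%act 'Alt_T%G S -> canonical 'P%act 'Alt_T%G S.
Proof.
move=> T5 [SG [c Sc]].
have memS g : g \in 'Alt_T -> (g \in S)%:R = perm_sum c g.
  move=> gG; have := congr1 (fun f : {ffun _ -> _} => f g) Sc.
  rewrite /indicator ffunE => ->; rewrite sum_ffunE; apply: eq_bigr => a _.
  (* For fixed [a], the only star from [a] that contains [g] is the one ending at [g a]. *)
  rewrite sum_ffunE (bigD1 (g a)) //= big1 ?addr0 => [|b bga].
    by rewrite !ffunE in_star_perm gG eqxx /= /GRing.scale /= mulr1.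
  by rewrite !ffunE in_star_perm gG eq_sym (negbTE bga) /= scaler0.
have eqS g h : g \in S -> h \in 'Alt_T -> perm_sum c h = perm_sum c g -> h \in S.
  move=> gS hG; rewrite -(memS h hG) -(memS g (subsetP SG _ gS)) gS => /eqP.
  by case: (h \in S); rewrite // eq_sym oner_eq0.
have even_bool (g : {perm T}) : ~~ odd_perm g -> boolean (perm_sum c g).
  by rewrite -Alt_even => /memS <-; exists (g \in S).
have [] := disjoint_free_support T5 (cross_disjoint_free T5 even_bool).
  case=> r cr; apply: (@canonical_cover _ _ 'P%act 'Alt_T%G
      (fun g : {perm T} => star 'P 'Alt_T%G r (g r))).
  - by move=> g _; exists r, (g r).
  - by move=> g gS; rewrite in_star_perm (subsetP SG) //=.
  move=> g h gS; rewrite in_star_perm => /andP[hG /eqP hr]; rewrite hr; split=> //.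
  by apply: eqS gS hG _; apply: perm_sum_row hr.
case=> p cp.
apply: (@canonical_cover _ _ 'P%act 'Alt_T%G
    (fun g : {perm T} => star 'P 'Alt_T%G (g^-1%g p) p)).
- by move=> g _; exists (g^-1%g p), p.
- by move=> g gS; rewrite in_star_perm (subsetP SG) //= permKV.
move=> g h gS; rewrite in_star_perm => /andP[hG /eqP hr].
have hp : h^-1%g p = g^-1%g p by rewrite -[X in h^-1%g X]hr permK.
rewrite hp; split=> //; apply: eqS gS hG _.
rewrite -(invgK g) -(invgK h) -!(perm_sum_trans c); apply: perm_sum_row hp.
by move=> x y i j xp yp; rewrite (cross_trans c) cp.
Qed.

Theorem theorem6p3 (F : numFieldType) (n : nat) (hn : (5 <= n)%N) :
  ~ exists S : {set {perm 'I_n}},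
      noncanonical_CL_set F ('P)%act ('Alt_('I_n))%G S.
Proof.
by case=> S [clS]; apply; apply: Alt_CL_set_canonical clS; rewrite card_ord.
Qed.
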